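(* Let $a\in A$ be invertible such that $KaK\subset A$ is a simple $K$-$K$ sub-bimodule corresponding to $HgH$. Then for every $m\ge \mathrm{ht}(a)$, $$(KaK)^m=\{x\in A \mid x\ell=g^m(\ell)x \text{ for all } \ell\in E\}.$$
   Context: Setting: $F$ is a field, $A$ is a central simple $F$-algebra of degree $n$ (so $\dim_F A=n^2$), and $K\subset A$ is a maximal subfield, separable over $F$, with $[K:F]=n$. $L$ is the Galois closure of $K/F$, $G=\mathrm{Gal}(L/F)$, $H=\mathrm{Gal}(L/K)$. For $a\in A$, $KaK$ denotes the $F$-span of all $kak'$ with $k,k'\in K$; products of subspaces are the $F$-spans of products of elements; $(KaK)^0=K$. Correspondence: for $g\in G$ let $\pi_{gH}:K\otimes_F K\to L$, $a\otimes b\mapsto a\,g(b)$, and let $K_{[g]}$ be the unique minimal ideal of the semisimple ring $K\otimes_F K$ not contained in $\ker\pi_{gH}$ (it depends only on $HgH$). Choose $v\in A$ with $KvK=A$ and let $\varphi_v:K\otimes_F K\to A$, $x\otimes y\mapsto xvy$ (a bimodule isomorphism). The simple sub-bimodule corresponding to $HgH$ is $\varphi_v(K_{[g]})$ (independent of $v$). Height: for $m\ge0$ put $K(a,m)=(KaK)^ma^{-m}$ (an ascending chain with $K(a,0)=K$); $\mathrm{ht}(a)$ is the minimal $m_0$ with $K(a,m_0)=K(a,m_0+1)$. The field $E$: let $m_0=\mathrm{ht}(a)$ and $N=H(g,m_0)$, where $H(g,m)=H(gHg^{-1})(g^2Hg^{-2})\cdots(g^mHg^{-m})$. $N$ is a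 subgroup of $G$ (the smallest normal subgroup of $\langle H,g\rangle$ containing $H$), and $E=L^N\subseteq K$ is its fixed field; $E$ is stable under $g$. *)

(* Defs.v *)
From HB Require Import structures.
From mathcomp Require Import all_boot all_order all_fingroup all_algebra all_field.

Set Implicit Arguments.
Unset Strict Implicit.
Unset Printing Implicit Defensive.

Import GRing.Theory.
Import VectorInternalTheory.
Local Open Scope ring_scope.

(* The tensor product U (x)_F V of two finite-dimensional F-algebras. With      *)
(* e_i, f_j the coordinate bases of U and V, the matrix t stands for            *)
(* \sum_i \sum_j t i j *: (e_i (x) f_j). [tensor_lift beta] is the linear map   *)
(* induced by a bilinear map beta (see [tensor_liftE] and [tensor_ind]), and    *)
(* the product is the one with (x (x) y)(x' (x) y') = xx' (x) yy' ([tensM]).    *)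
Section Tensor.

Variables (F : fieldType) (U V : falgType F).

Definition tensor : Type := 'M[F]_(dim U, dim V).
HB.instance Definition _ := Vector.on tensor.

Definition tens (x : U) (y : V) : tensor := (v2r x)^T *m v2r y.

Definition tbasisl (i : 'I_(dim U)) : U := r2v (delta_mx 0 i).
Definition tbasisr (j : 'I_(dim V)) : V := r2v (delta_mx 0 j).

Definition bilin (W : vectType F) (beta : U -> V -> W) : Prop :=
  (forall y, linear (beta^~ y)) /\ (forall x, linear (beta x)).

Definition tensor_lift (W : vectType F) (beta : U -> V -> W) (t : tensor) : W :=
  \sum_i \sum_j t i j *: beta (tbasisl i) (tbasisr j).

Lemma tensor_lift_linear (W : vectType F) (beta : U -> V -> W) :
  linear (tensor_lift beta).
Proof.
move=> c s t; rewrite /tensor_lift scaler_sumr -big_split /=.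
apply: eq_bigr => i _; rewrite scaler_sumr -big_split /=.
by apply: eq_bigr => j _; rewrite !mxE scalerDl scalerA.
Qed.

HB.instance Definition _ (W : vectType F) (beta : U -> V -> W) :=
  GRing.isLinear.Build F tensor W _ (tensor_lift beta)
    (tensor_lift_linear beta).

Lemma tensor_lift_linear_fun (W : vectType F) (b b1 b2 : U -> V -> W)
    c t :
  (forall x y, b x y = c *: b1 x y + b2 x y) ->
  tensor_lift b t = c *: tensor_lift b1 t + tensor_lift b2 t.
Proof.
move=> bE; rewrite /tensor_lift scaler_sumr -big_split /=.
apply: eq_bigr => i _; rewrite scaler_sumr -big_split /=; apply: eq_bigr => k _.
by rewrite bE scalerDr !scalerA mulrC.
Qed.

Lemma tbasislE x : x = \sum_i v2r x 0 i *: tbasisl i.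
Proof.
apply: v2r_inj; rewrite linear_sum [LHS]row_sum_delta; apply: eq_bigr => i _.
by rewrite linearZ /= /tbasisl r2vK.
Qed.

Lemma tbasisrE y : y = \sum_j v2r y 0 j *: tbasisr j.
Proof.
apply: v2r_inj; rewrite linear_sum [LHS]row_sum_delta; apply: eq_bigr => i _.
by rewrite linearZ /= /tbasisr r2vK.
Qed.

Lemma linear_sumZ (X Y : lmodType F) (f : X -> Y) (I : finType) c (u : I -> X) :
  linear f -> f (\sum_i c i *: u i) = \sum_i c i *: f (u i).
Proof.
move=> lf; have f0: f 0 = 0.
  by have := lf (-1) 0 0; rewrite scaler0 addr0 scaleN1r addNr.
pose P (x : X) (y : Y) := f x = y; apply: (big_ind2 P) => //.
  by move=> x1 y1 x2 y2 <- <-; have := lf 1 x1 x2; rewrite !scale1r.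
by move=> i _; have := lf (c i) (u i) 0; rewrite /P !addr0 f0 addr0.
Qed.

Lemma tensor_liftE (W : vectType F) (beta : U -> V -> W) x y :
  bilin beta -> tensor_lift beta (tens x y) = beta x y.
Proof.
case=> bl br; rewrite {2}(tbasislE x) (linear_sumZ _ _ (bl y)).
apply: eq_bigr => i _; rewrite {2}(tbasisrE y) (linear_sumZ _ _ (br _)).
rewrite scaler_sumr; apply: eq_bigr => j _.
by rewrite scalerA mxE big_ord1 mxE.
Qed.

Lemma tens_bilin : bilin tens.
Proof.
split=> [y c x x' | x c y y'] /=; rewrite /tens.
  by rewrite linearP /= linearP /= mulmxDl -scalemxAl.
by rewrite linearP /= mulmxDr -scalemxAr.
Qed.

Lemma tens_delta i j : tens (tbasisl i) (tbasisr j) = delta_mx i j.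
Proof. by rewrite /tens /tbasisl /tbasisr !r2vK trmx_delta mul_delta_mx. Qed.

Lemma tensor_lift_id (t : tensor) : tensor_lift tens t = t.
Proof.
rewrite [RHS]matrix_sum_delta; apply: eq_bigr => i _; apply: eq_bigr => j _.
by rewrite tens_delta.
Qed.

Lemma tensor_ind (P : tensor -> Prop) :
  (forall c s t, P s -> P t -> P (c *: s + t)) ->
  (forall x y, P (tens x y)) -> forall t, P t.
Proof.
move=> Plin Ptens t.
have P0: P 0 by have := Plin (-1) _ _ (Ptens 0 0) (Ptens 0 0); rewrite scaleN1r addNr.
have PD s s' : P s -> P s' -> P (s + s').
  by move=> Ps Ps'; have := Plin 1 _ _ Ps Ps'; rewrite scale1r.
rewrite -[t]tensor_lift_id; apply: big_ind => // i _; apply: big_ind => // j _.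
by have := Plin (t i j) _ _ (Ptens (tbasisl i) (tbasisr j)) P0; rewrite addr0.
Qed.

Definition tensor_mul (s t : tensor) : tensor :=
  tensor_lift (fun x y => tensor_lift (fun x' y' => tens (x * x') (y * y')) t) s.

Definition tensor_one : tensor := tens 1 1.

Lemma tens_mul_bilin x y : bilin (fun x' y' => tens (x * x') (y * y')).
Proof.
have [tl tr] := tens_bilin; split=> [y' c u v | x' c u v] /=.
  by rewrite mulrDr -scalerAr tl.
by rewrite mulrDr -scalerAr tr.
Qed.

Lemma tensor_mul_linl t : linear (tensor_mul^~ t).
Proof. by move=> c s s'; rewrite /tensor_mul tensor_lift_linear. Qed.

Lemma tensor_mul_linr s : linear (tensor_mul s).
Proof.
move=> c t t'; apply: tensor_lift_linear_fun => x y.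
by rewrite tensor_lift_linear.
Qed.

Lemma tensor_mulE x y x' y' :
  tensor_mul (tens x y) (tens x' y') = tens (x * x') (y * y').
Proof.
rewrite /tensor_mul tensor_liftE; first by rewrite tensor_liftE //; exact: tens_mul_bilin.
have [tl tr] := tens_bilin.
split=> [v c u u' | u c v v'] /=; rewrite !tensor_liftE; do ?exact: tens_mul_bilin.
  by rewrite mulrDl -scalerAl tl.
by rewrite mulrDl -scalerAl tr.
Qed.

Lemma tensor_mulA : associative tensor_mul.
Proof.
move=> r s t; elim/tensor_ind: r => [c r r' IH IH' | x y].
  by rewrite !tensor_mul_linl IH IH'.
elim/tensor_ind: s => [c s s' IH IH' | x' y'].
  by rewrite tensor_mul_linl !tensor_mul_linr tensor_mul_linl IH IH'.
elim/tensor_ind: t => [c t t' IH IH' | x'' y''].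
  by rewrite !tensor_mul_linr IH IH'.
by rewrite !tensor_mulE !mulrA.
Qed.

Lemma tensor_mul1 : left_id tensor_one tensor_mul.
Proof.
elim/tensor_ind=> [c s t IH IH' | x y]; first by rewrite tensor_mul_linr IH IH'.
by rewrite tensor_mulE !mul1r.
Qed.

Lemma tensor_mulr1 : right_id tensor_one tensor_mul.
Proof.
elim/tensor_ind=> [c s t IH IH' | x y]; first by rewrite tensor_mul_linl IH IH'.
by rewrite tensor_mulE !mulr1.
Qed.

Lemma tensor_mulDl : left_distributive tensor_mul +%R.
Proof. by move=> r s t; have := tensor_mul_linl t 1 r s; rewrite !scale1r. Qed.

Lemma tensor_mulDr : right_distributive tensor_mul +%R.
Proof. by move=> r s t; have := tensor_mul_linr r 1 s t; rewrite !scale1r. Qed.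

Lemma tensor_one_neq0 : tensor_one != 0.
Proof.
apply/eqP => /matrixP t0.
have: v2r (1 : U) != 0 by rewrite -(linear0 v2r) (inj_eq (@v2r_inj _ _)) oner_neq0.
have: v2r (1 : V) != 0 by rewrite -(linear0 v2r) (inj_eq (@v2r_inj _ _)) oner_neq0.
case/rV0Pn=> j nzj /rV0Pn[i nzi]; move: (t0 i j).
by rewrite !mxE big_ord1 mxE => /eqP; rewrite mulf_eq0 (negPf nzi) (negPf nzj).
Qed.

HB.instance Definition _ := GRing.Zmodule_isNzRing.Build tensor
  tensor_mulA tensor_mul1 tensor_mulr1 tensor_mulDl tensor_mulDr
  tensor_one_neq0.

Lemma tensor_scaleAl (c : F) (s t : tensor) : c *: (s * t) = (c *: s) * t.
Proof.
have /= E := tensor_mul_linl t c s 0.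
by move: E; rewrite (mul0r t : tensor_mul 0 t = 0) !addr0 => <-.
Qed.

Lemma tensor_scaleAr (c : F) (s t : tensor) : c *: (s * t) = s * (c *: t).
Proof.
have /= E := tensor_mul_linr s c t 0.
by move: E; rewrite (mulr0 s : tensor_mul s 0 = 0) !addr0 => <-.
Qed.

HB.instance Definition _ :=
  GRing.Lmodule_isLalgebra.Build F tensor tensor_scaleAl.
HB.instance Definition _ :=
  GRing.Lalgebra_isAlgebra.Build F tensor tensor_scaleAr.
HB.instance Definition _ := Algebra_isFalgebra.Build F tensor.

Lemma tensM x y x' y' : tens x y * tens x' y' = tens (x * x') (y * y').
Proof. exact: tensor_mulE. Qed.

End Tensor.

Section Algebras.

Variables (F : fieldType) (A : falgType F).

(* Two-sided ideals of an F-algebra are automatically F-subspaces. *)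
Definition is_ideal (I : {vspace A}) : Prop :=
  (({:A} * I)%VS <= I)%VS /\ ((I * {:A})%VS <= I)%VS.

Definition minimal_ideal (I : {vspace A}) : Prop :=
  [/\ is_ideal I, I != 0%VS
    & forall J : {vspace A}, is_ideal J -> (J <= I)%VS -> J = 0%VS \/ J = I].

Definition central_simple : Prop :=
  'Z({:A})%VS = 1%VS /\
  forall I : {vspace A}, is_ideal I -> I = 0%VS \/ I = {:A}%VS.

(* An {aspace A} may have a unit other than that of A, hence 1 \in K. *)
Definition is_subfield (K : {aspace A}) : Prop :=
  [/\ 1 \in K, {in K &, commutative *%R}
    & forall x, x \in K -> x != 0 -> x \is a GRing.unit /\ x^-1 \in K].

Definition maximal_subfield (K : {aspace A}) : Prop :=
  is_subfield K /\
  forall K' : {aspace A}, is_subfield K' -> (K <= K')%VS -> K' = K.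

Variable K : {aspace A}.

Definition sub_bimodule (V : {vspace A}) : Prop := (K * V * K <= V)%VS.

Definition simple_sub_bimodule (V : {vspace A}) : Prop :=
  [/\ sub_bimodule V, V != 0%VS
    & forall W : {vspace A}, sub_bimodule W -> (W <= V)%VS -> W = 0%VS \/ W = V].

Definition KaK (a : A) : {vspace A} := (K * <[a]> * K)%VS.

Definition KaKX (a : A) (m : nat) : {vspace A} :=
  if m is 0 then K : {vspace A} else (KaK a ^+ m)%VS.

Definition Kam (a : A) (m : nat) : {vspace A} := (KaKX a m * <[a ^- m]>)%VS.

Definition is_height (a : A) (m0 : nat) : Prop :=
  Kam a m0 = Kam a m0.+1 /\ forall m, Kam a m = Kam a m.+1 -> (m0 <= m)%N.

Lemma Kam_sub a m :
  1 \in K -> a \is a GRing.unit -> (Kam a m <= Kam a m.+1)%VS.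
Proof.
move=> K1 ua; have aK : a \in KaK a.
  rewrite -[X in X \in _]mulr1 -[X in X * 1]mul1r.
  by rewrite !memv_mul ?memv_line.
have step : (KaKX a m * <[a]> <= KaKX a m.+1)%VS.
  case: m => [|m] /=.
    by rewrite expv1 /KaK -{1}[(K * <[a]>)%VS]prodv1 prodvSr // -memvE.
  by rewrite [X in (_ <= X)%VS]expvSr prodvSr // -memvE.
have e : a ^- m = a * a ^- m.+1.
  by rewrite exprSr invrM ?unitrX // mulVKr.
rewrite {1}/Kam e; apply: subv_trans (prodvSl _ step).
rewrite -prodvA; apply: prodvSr.
by rewrite -memvE memv_mul ?memv_line.
Qed.

Lemma height_exists a :
  1 \in K -> a \is a GRing.unit -> exists m0, is_height a m0.
Proof.
move=> K1 ua; have ex : exists m, Kam a m == Kam a m.+1.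
  have [/existsP[m h]|/existsPn no] :=
      boolP [exists m : 'I_(\dim {:A}).+1, Kam a m == Kam a m.+1].
    by exists m.
  have grow m : (m <= (\dim {:A}).+1)%N -> (m <= \dim (Kam a m))%N.
    elim: m => // m IH lt_m; apply: leq_ltn_trans (IH (ltnW lt_m)) _.
    rewrite ltn_neqAle dimvS ?Kam_sub // andbT.
    by have := no (Ordinal lt_m); rewrite /= eqEdim Kam_sub //= -ltnNge;
       rewrite ltn_neqAle => /andP[].
  by have := leq_trans (grow _ (leqnn _)) (dimvS (subvf _)); rewrite ltnn.
by case: (ex_minnP ex) => m0 /eqP h min; exists m0; split=> // m /eqP /min.
Qed.

End Algebras.

(* The Galois closure L of K/F comes with an F-embedding j : K -> L; the        *)
(* elements of G are the g : gal_of {:L}, and H = 'Gal({:L} / j K).             *)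
Section Correspondence.

Variables (F : fieldType) (A : falgType F) (K : {aspace A}).
Variables (L : splittingFieldType F) (j : 'AHom(subvs_of K, L)).

Definition Kimg : {vspace L} := limg j.

Definition galois_closure (M : {vspace L}) : Prop :=
  galois 1 {:L} /\
  forall E : {subfield L}, (M <= E)%VS -> galois 1 E -> E = {:L}%AS.

Definition pi_ (g : gal_of {:L}) : 'Hom(tensor (subvs_of K) (subvs_of K), L) :=
  linfun (tensor_lift (fun x y : subvs_of K => j x * g (j y))).

Definition phi_ (v : A) : 'Hom(tensor (subvs_of K) (subvs_of K), A) :=
  linfun (tensor_lift (fun x y : subvs_of K => vsval x * v * vsval y)).

Definition is_Kg (g : gal_of {:L})
    (I : {vspace tensor (subvs_of K) (subvs_of K)}) : Prop :=
  minimal_ideal I /\ ~~ (I <= lker (pi_ g))%VS.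

Definition corresponds (V : {vspace A}) (g : gal_of {:L}) : Prop :=
  exists v : A, KaK K v = {:A}%VS /\
  exists I, is_Kg g I /\ V = (phi_ v @: I)%VS.

(* The group law of gal_of is (x * y) l = y (x l), opposite to composition of   *)
(* automorphisms as functions. Hence g^i H g^-i is H :^ (g ^+ i) here, and the  *)
(* product H (g H g^-1) ... (g^m H g^-m) is written from right to left.         *)
Fixpoint Hgm (g : gal_of {:L}) (m : nat) : {set gal_of {:L}} :=
  if m is m'.+1 then ('Gal({:L} / Kimg) :^ (g ^+ m) * Hgm g m')%g
  else 'Gal({:L} / Kimg)%g.

(* [KtoA l] is the element of K \subset A whose image under j is l, for l in    *)
(* j K; it is only meaningful there.                                            *)
Definition KtoA (l : L) : A := vsval ((j^-1)%VF l).

End Correspondence.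

(* Main.v *)
Require Import Defs.
From HB Require Import structures.
From mathcomp Require Import all_boot all_order all_fingroup all_algebra all_field.

(** Write B for K(a, m0) = K (a K a^-1) ... (a^m0 K a^-m0), the stable value of
  the chain. Since K(a, m + 1) = K a K(a, m) a^-1, the chain is constant from m0
  on, and B satisfies K B = B and a B a^-1 = B; hence B is a subalgebra
  containing K, and (KaK)^m = B a^m for all m >= m0. The problem becomes to
  recognise B, and B is the centraliser of its own centraliser
  ([double_centraliser]); so it is enough to identify C(B) with E.

  The double centraliser property of B comes from K <= B. As
  [A : F] = [K : F]^2, the operators y |-> \sum_i k_i y w_i with k_i in K form a
  space of dimension n^3, the relations among them being trivial
  ([two_sided_free]); they therefore fill End_K(A), and one of them sends a given
  z <> 0 to 1 and A into K ([rank_one_op]). So A is a simple module over B (x)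
  A^op, with endomorphisms the left multiplications by C(B). Jacobson's density
  argument then writes left multiplication by any x in C(C(B)) as
  y |-> \sum_i b_i y w_i with b_i in B, which forces x into B by
  [two_sided_free] again.

  To identify C(B), note that C(B) <= C(K) = K. The correspondence between KaK and
  HgH says that, for l and l' in K, l a = a l' holds in A exactly when l = g(l')
  holds in L ([corresponds_comm]). An element c of C(B) stays in C(B) <= K
  after any number of conjugations by a, so it lies in every g^i(K) and is fixed
  by every g^i H g^-i. Conversely an element fixed by g^i H g^-i for i <= m0
  lies in g^i(K) for i <= m0, and thus commutes with all the factors
  a^i K a^-i of B ([cent_chain]). So C(B) = E, and conjugation by a on C(B) is g;
  x in B a^m then means that x a^-m commutes with C(B), that is
  x l = g^m(l) x on E. *)

Set Implicit Arguments.
Unset Strict Implicit.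
Unset Printing Implicit Defensive.

Import GRing.Theory.
Local Open Scope ring_scope.

(** * Two-sided multiplications in a central simple algebra *)

Section Products.

Variables (F : fieldType) (A : falgType F).

Lemma prodv_ind (U V : {vspace A}) (P : A -> Prop) :
    P 0 -> (forall c x y, P x -> P y -> P (c *: x + y)) ->
    {in U & V, forall u v, P (u * v)} ->
  forall x, x \in (U * V)%VS -> P x.
Proof.
move=> P0 PZD Pmul x; rewrite [@prodv _ _]unlock.
set X := allpairs _ _ _ => /(@coord_span _ _ _ (in_tuple X))->.
apply: (big_ind P) => // [y z Py Pz | i _].
  by have := PZD 1 y z Py Pz; rewrite scale1r.
have /allpairsP[[u v] /= [/vbasis_mem Uu /vbasis_mem Vv ->]] :
    (in_tuple X)`_i \in X.
  by rewrite mem_nth.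
by have := PZD (coord (in_tuple X) i x) _ _ (Pmul u v Uu Vv) P0; rewrite addr0.
Qed.

(** The action on A of the element \sum_i s_i (x) w_i of A (x) A^op; w is indexed
  by nat so that inductions on s need no casts. *)
Definition two_sided (s : seq A) (w : nat -> A) (y : A) : A :=
  \sum_(i < size s) s`_i * y * w i.

Fact two_sided_linear s w : linear (two_sided s w).
Proof.
move=> c y1 y2; rewrite /two_sided scaler_sumr -big_split.
apply: eq_bigr => i _ /=.
by rewrite mulrDr mulrDl -scalerAr -scalerAl.
Qed.
HB.instance Definition _ s w :=
  GRing.isLinear.Build F A A _ (two_sided s w) (two_sided_linear s w).

End Products.

Section CentralSimple.

Variables (F : fieldType) (A : falgType F).
Hypothesis csA : @central_simple F A.

Lemma simple_span (w : A) : w != 0 -> ({:A} * <[w]> * {:A})%VS = {:A}%VS.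
Proof.
move=> nz_w; set I := (_ * _ * _)%VS.
have wI : w \in I by rewrite -[w]mulr1 -[w]mul1r !memv_mul ?memv_line ?memvf.
have [_ /(_ I)[|I0|//]] := csA; first split.
- by rewrite /I !prodvA !prodvSl // subvf.
- by rewrite /I -prodvA prodvSr // subvf.
by move: wI; rewrite I0 memv0 (negPf nz_w).
Qed.

(** This is the injectivity of A (x) A^op -> End_F(A). In a relation whose first
  coefficient w_0 is nonzero, simplicity of A lets one replace w_0 by 1. The
  commutators of the coefficients with any z then satisfy a relation without
  the first term, so they vanish, and all coefficients are central, i.e. scalars:
  at y = 1 this contradicts the freeness of s. *)
Lemma two_sided_free (s : seq A) (w : nat -> A) :
    free s -> (forall y, two_sided s w y = 0) ->
  forall i, (i < size s)%N -> w i = 0.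
Proof.
elim: s w => [//|b s IH] w; rewrite free_cons => /andP[notsb frs] w_rel.
have [w0 | nz_w0] := eqVneq (w 0%N) 0.
  case=> [//|i] lt_i_s; apply: (IH (fun i => w i.+1)) => // y.
  by have := w_rel y; rewrite /two_sided big_ord_recl w0 mulr0 add0r.
(* The possible leading coefficients form a two-sided ideal, containing w 0. *)
pose P p := exists w', w' 0%N = p /\ forall y, two_sided (b :: s) w' y = 0.
have P0 : P 0.
  by exists (fun=> 0); split=> // y; apply: big1 => i _; rewrite mulr0.
have PZD c p q : P p -> P q -> P (c *: p + q).
  case=> [wp [<- rp]] [wq [<- rq]].
  exists (fun i => c *: wp i + wq i); split=> // y.
  transitivity (c *: two_sided (b :: s) wp y + two_sided (b :: s) wq y).
    rewrite scaler_sumr -big_split; apply: eq_bigr => i _ /=.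
    by rewrite mulrDr -scalerAr.
  by rewrite rp rq scaler0 addr0.
have [w1 [w10 w1_rel]] : P 1.
  have: 1 \in ({:A} * <[w 0%N]> * {:A})%VS by rewrite simple_span ?memvf.
  apply: prodv_ind => // u v Au _.
  apply: (prodv_ind (P := fun u => P (u * v)) _ _ _ Au).
  - by rewrite mul0r.
  - by move=> c p q Pp Pq; rewrite mulrDl -scalerAl; apply: PZD.
  move=> r _ _ /vlineP[c ->].
  exists (fun i => r * (c *: w i) * v); split=> // y.
  transitivity (c *: (two_sided (b :: s) w (y * r) * v)).
    rewrite mulr_suml scaler_sumr; apply: eq_bigr => i _.
    by rewrite -scalerAr -scalerAl -scalerAr !mulrA.
  by rewrite w_rel mul0r scaler0.
have w1C i : (i < size s)%N -> exists c : F, w1 i.+1 = c%:A.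
  move=> lt_i_s; apply/vlineP; have [<- _] := csA.
  rewrite memv_cap memvf; apply/centvP => z _; apply/eqP.
  rewrite -subr_eq0; apply/eqP.
  pose w2 k := w1 k.+1 * z - z * w1 k.+1.
  apply: (IH w2) => // y.
  (* The relation times z, minus the relation at y * z: leading terms cancel. *)
  have := congr2 (fun p q => p * z - q) (w1_rel y) (w1_rel (y * z)).
  rewrite mul0r subr0 /two_sided !big_ord_recl /= w10 !mulr1 mulrDl !mulrA.
  rewrite opprD addrACA subrr add0r mulr_suml -sumrB => E; rewrite -[RHS]E.
  by apply: eq_bigr => k _; rewrite mulrBr !mulrA.
have Db : b = - \sum_(i < size s) s`_i * 1 * w1 i.+1.
  by apply/eqP; rewrite -addr_eq0; have := w1_rel 1;
    rewrite /two_sided big_ord_recl /= w10 !mulr1 => /eqP.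
case/negP: notsb; rewrite Db rpredN; apply: rpred_sum => i _.
have [c ->] := w1C i (ltn_ord i).
by rewrite mulr1 -scalerAr mulr1 memvZ ?memv_span ?mem_nth.
Qed.

End CentralSimple.

Section Subfield.
Variables (F : fieldType) (A : falgType F) (csA : @central_simple F A).
Variables (K : {aspace A}) (fieldK : is_subfield K).
Hypothesis dimA : \dim {:A} = (\dim K ^ 2)%N.
Local Notation n := (\dim K).

(** A left K-basis of A, started at z. It has n elements because the sum of the
  lines K y is direct and each has dimension n = [K : F]. *)
Lemma subfield_span (z : A) : z != 0 ->
  exists2 ys, size (z :: ys) = n & (\sum_(y <- z :: ys) K * <[y]>)%VS = {:A}%VS.
Proof.
have [K1 _ Kinv] := fieldK; have n_gt0 : (0 < n)%N by rewrite adim_gt0.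
move=> nz_z; pose M (ys : seq A) := (\sum_(y <- ys) K * <[y]>)%VS.
have KM ys : (K * M ys)%VS = M ys.
  rewrite /M; elim: ys => [|y ys IH]; rewrite ?big_nil ?prodv0 //.
  by rewrite !big_cons prodvDr IH prodvA prodv_id.
have dimM w ys : w \notin M ys -> \dim (K * <[w]> + M ys) = (n + \dim (M ys))%N.
  move=> Mw; rewrite dimv_disjoint_sum.
    rewrite -limg_amulr limg_dim_eq //.
    apply/eqP; rewrite -subv0; apply/subvP=> k /memv_capP[Kk].
    rewrite memv_ker lfunE /= memv0; apply: contraTT => /(Kinv _ Kk)[uk _].
    rewrite -[0](mulr0 k) (inj_eq (mulrI uk)).
    by apply: contraNneq Mw => ->; apply: mem0v.
  apply/eqP; rewrite -subv0; apply/subvP=> u /memv_capP[].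
  rewrite -limg_amulr => /memv_imgP[k Kk ->]; rewrite lfunE /= memv0 => Mkw.
  have [->|/(Kinv _ Kk)[uk Kk']] := eqVneq k 0; first by rewrite mul0r.
  by case/negP: Mw; rewrite -(mulKr uk w) -KM memv_mul.
have step r : (r < n)%N ->
    exists2 ys, size ys = r & \dim (M (z :: ys)) = (r.+1 * n)%N.
  elim: r => [_ | r IH lt_r1_n].
    exists [::] => //; rewrite /M big_cons -/(M [::]) dimM.
      by rewrite /M big_nil dimv0 addn0 mul1n.
    by rewrite /M big_nil memv0.
  have [ys szys dimys] := IH (ltnW lt_r1_n).
  have /subvPn[w _ Mw] : ~~ ({:A} <= M (z :: ys))%VS.
    by apply/negP=> /dimvS; rewrite dimA dimys leq_pmul2r // leqNgt lt_r1_n.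
  exists (w :: ys); first by rewrite /= szys.
  have -> : M [:: z, w & ys] = (K * <[w]> + M (z :: ys))%VS.
    by rewrite /M !big_cons !addvA [(K * <[z]> + _)%VS]addvC.
  by rewrite dimM // dimys [RHS]mulSn.
have [|ys szys dimys] := step n.-1; first by rewrite prednK.
exists ys; first by rewrite /= szys prednK.
by apply/eqP; rewrite eqEdim subvf dimA dimys prednK //= mulnn.
Qed.

(** The map sending (w_i) to the values of y |-> \sum_i k_i y w_i on a K-basis of A
  is an injective endomorphism of A^n, the operator being left K-linear; hence it
  is onto, and the operator can be prescribed to be 1 on z and 0 on the other
  basis vectors. *)
Lemma rank_one_op (z : A) : z != 0 ->
  exists w : nat -> A, two_sided (vbasis K) w z = 1 /\
    forall y, two_sided (vbasis K) w y \in K.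
Proof.
move=> nz_z; have [K1 Kcomm _] := fieldK.
have [ys szys spanys] := subfield_span nz_z.
pose q w := two_sided (vbasis K) w.
have frK : free (vbasis K) by exact: basis_free (vbasisP K).
have szK : size (vbasis K) = n by rewrite size_tuple.
have vK (i : 'I_(size (vbasis K))) : (vbasis K)`_i \in K.
  by rewrite vbasis_mem ?mem_nth.
have qK w k y : k \in K -> q w (k * y) = k * q w y.
  move=> Kk; rewrite /q mulr_sumr; apply: eq_bigr => i _.
  by rewrite !mulrA (Kcomm _ k) // vK.
pose ext (w : {ffun 'I_n -> A}) i := if insub i is Some o then w o else 0.
have extE w (i : 'I_n) : ext w i = w i by rewrite /ext valK.
pose Phi (w : {ffun 'I_n -> A}) := [ffun j : 'I_n => q (ext w) (z :: ys)`_j].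
have Phi_lin : linear Phi.
  move=> c w1 w2; apply/ffunP=> j; rewrite !ffunE /q /two_sided szK.
  rewrite scaler_sumr -big_split; apply: eq_bigr => i _.
  by rewrite !extE !ffunE mulrDr -scalerAr.
have span y : y \in (\sum_(i < n) K * <[(z :: ys)`_i]>)%VS.
  by have := memvf y; rewrite -spanys (big_nth 0) big_mkord szys.
pose PhiL := GRing.isLinear.Build F _ _ _ Phi Phi_lin.
pose f : 'End({ffun 'I_n -> A}) :=
  linfun (HB.pack_for {linear _ -> _} Phi PhiL).
have fE w : f w = Phi w by rewrite lfunE.
have kerf : lker f == 0%VS.
  rewrite -subv0; apply/subvP=> w; rewrite memv_ker memv0 fE => /eqP w0.
  apply/eqP/ffunP=> i; rewrite ffunE -extE.
  apply: (two_sided_free csA frK); last by rewrite szK.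
  move=> y; have /memv_sumP[u uP ->] := span y.
  rewrite linear_sum big1 // => k _; have := uP k isT.
  rewrite -limg_amulr => /memv_imgP[l Kl ->]; rewrite lfunE /= -/(q _ _) qK //.
  by have /ffunP/(_ k) := w0; rewrite !ffunE => ->; rewrite mulr0.
have n_gt0 : (0 < n)%N by rewrite -szys.
pose o := Ordinal n_gt0.
have /memv_imgP[w _ Dw] : [ffun j : 'I_n => (j == o)%:R : A] \in limg f.
  by rewrite lker0_limgf // memvf.
exists (ext w); have qw (i : 'I_n) : q (ext w) (z :: ys)`_i = (i == o)%:R.
  by have /ffunP/(_ i) := Dw; rewrite fE !ffunE.
split=> [|y]; first exact: (qw o).
have /memv_sumP[u uP ->] := span y.
rewrite linear_sum rpred_sum // => k _; have := uP k isT.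
rewrite -limg_amulr => /memv_imgP[l Kl ->]; rewrite lfunE /= -/(q _ _) qK // qw.
by case: (k == o); rewrite ?mulr1 // mulr0 mem0v.
Qed.

(** With z = 1 in [rank_one_op], the operator maps c to c * 1 = c. *)
Lemma cent_subfield c : c \in 'C(K)%VS -> c \in K.
Proof.
move=> /centvP cK; have [w [w1 wK]] := rank_one_op (oner_neq0 A).
rewrite -[c]mulr1 -w1 /two_sided mulr_sumr.
rewrite (_ : \sum_i _ = two_sided (vbasis K) w c) ?wK //.
apply: eq_bigr => i _; rewrite !mulrA mulr1 cK //.
by rewrite vbasis_mem ?mem_nth.
Qed.

End Subfield.

(** * Density and the double centraliser *)

Section Density.

Variables (F : fieldType) (A : falgType F) (csA : @central_simple F A).
Variables (K : {aspace A}) (fieldK : is_subfield K).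
Hypothesis dimA : \dim {:A} = (\dim K ^ 2)%N.
Variables (B : {vspace A}) (sKB : (K <= B)%VS) (sBB : (B * B <= B)%VS).

(** The image of B (x) A^op in End_F(A). *)
Definition mult_op (t : A -> A) : Prop :=
  exists w, forall y, t y = two_sided (vbasis B) w y.

Lemma mult_opD t1 t2 :
  mult_op t1 -> mult_op t2 -> mult_op (fun y => t1 y + t2 y).
Proof.
case=> [w1 D1] [w2 D2]; exists (fun i => w1 i + w2 i) => y.
by rewrite D1 D2 -big_split; apply: eq_bigr => i _; rewrite mulrDr.
Qed.

Lemma mult_op0 : mult_op (fun=> 0).
Proof.
by exists (fun=> 0) => y; rewrite /two_sided big1 // => i _; rewrite mulr0.
Qed.

Lemma mult_op_sum m (t : 'I_m -> A -> A) :
  (forall i, mult_op (t i)) -> mult_op (fun y => \sum_i t i y).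
Proof.
elim: m t => [|m IH] t t_op.
  by have [w Dw] := mult_op0; exists w => y; rewrite big_ord0 -Dw.
have [w Dw] := mult_opD (t_op ord0) (IH _ (fun i => t_op (lift ord0 i))).
by exists w => y; rewrite big_ord_recl Dw.
Qed.

Lemma mult_op_mul b z : b \in B -> mult_op (fun y => b * y * z).
Proof.
move=> Bb; pose w i := if insub i is Some o then coord (vbasis B) o b *: z else 0.
exists w => y.
rewrite {1}(coord_vbasis Bb) /two_sided size_tuple !mulr_suml.
by apply: eq_bigr => i _; rewrite /w valK -!scalerAl -scalerAr.
Qed.

Lemma mult_op_comp t b z :
  b \in B -> mult_op t -> mult_op (fun y => b * t y * z).
Proof.
move=> Bb [w Dt]; have vB (i : 'I_(size (vbasis B))) : (vbasis B)`_i \in B.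
  by rewrite vbasis_mem ?mem_nth.
have [w' Dw'] : mult_op (fun y => \sum_(i < size (vbasis B))
    b * (vbasis B)`_i * y * (w i * z)).
  by apply: mult_op_sum => i; apply: mult_op_mul; rewrite (subvP sBB) ?memv_mul.
exists w' => y; rewrite -Dw' Dt mulr_sumr mulr_suml.
by apply: eq_bigr => i _; rewrite !mulrA.
Qed.

Lemma mult_op_linear t : mult_op t -> linear t.
Proof. by case=> w Dt c y z; rewrite !Dt linearP. Qed.

Lemma mult_op_cent t c y : mult_op t -> c \in 'C(B)%VS -> t (c * y) = c * t y.
Proof.
case=> w Dt /centvP cB; rewrite !Dt mulr_sumr; apply: eq_bigr => i _.
by rewrite !mulrA cB // vbasis_mem ?mem_nth.
Qed.

(** The simplicity of A as a module over K (x) A^op, hence over B (x) A^op. As s is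
  t followed by such an operator, it kills what t kills. *)
Lemma mult_op_to1 t u : mult_op t -> t u != 0 ->
  exists s, [/\ mult_op s, s u = 1 & forall y, t y = 0 -> s y = 0].
Proof.
move=> t_op nz_tu; have [w [w1 _]] := rank_one_op csA fieldK dimA nz_tu.
exists (fun y => two_sided (vbasis K) w (t y)).
split=> // [|y ->]; last exact: linear0.
apply: mult_op_sum => i; apply: mult_op_comp => //.
by rewrite (subvP sKB) // vbasis_mem ?mem_nth.
Qed.

(** Jacobson density, by induction on ys. When some operator t kills ys but not u,
  it can be normalised to s u = 1. Then c = s y commutes with B, and every
  operator killing ys sends y and c u to the same element; so y - c u falls under
  the induction hypothesis. *)
Lemma density (ys : seq A) y :
    (forall t, mult_op t -> {in ys, forall u, t u = 0} -> t y = 0) ->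
  y \in (\sum_(u <- ys) 'C(B) * <[u]>)%VS.
Proof.
have [K1 _ _] := fieldK; have B1 := subvP sKB 1 K1.
elim: ys y => [|u ys IH] y kill_y.
  rewrite big_nil memv0 -[y]mulr1 -[y]mul1r; apply/eqP.
  by apply: (kill_y (fun y => 1 * y * 1)) => //; apply: mult_op_mul.
apply: contraT => notCy.
suff Cy : y \in (\sum_(u <- ys) 'C(B) * <[u]>)%VS.
  by case/negP: notCy; rewrite big_cons (subvP (addvSr _ _)).
apply: (IH _) => t t_op kill_t; apply: (kill_y t t_op) => v.
rewrite inE => /predU1P[->|]; last exact: kill_t.
apply: contraNeq notCy => nz_tu; rewrite big_cons.
have [s [s_op su kill_s]] := mult_op_to1 t_op nz_tu.
have {}kill_s : {in ys, forall v, s v = 0} by move=> ? /kill_t/kill_s.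
have Cc : s y \in 'C(B)%VS.
  apply/centvP=> b Bb; apply/esym/eqP; rewrite -subr_eq0; apply/eqP.
  have := kill_y (fun y => b * s y * 1 + 1 * s y * - b).
  rewrite mulr1 mul1r mulrN; apply.
    by apply: mult_opD; apply: mult_op_comp.
  move=> u'; rewrite inE => /predU1P[->|/kill_s->].
    by rewrite su !mulr1 mul1r subrr.
  by rewrite !mulr0 !mul0r addr0.
rewrite -[y](subrKC (s y * u)) memv_add ?memv_mul ?memv_line //.
apply: IH => r r_op kill_r.
rewrite [_ - _]addrC -scaleN1r (mult_op_linear r_op) (mult_op_cent _ r_op Cc).
rewrite scaleN1r.
have := kill_y (fun y => r y + 1 * s y * - r u).
rewrite mul1r mulrN addrC; apply.
  by apply: mult_opD; last apply: mult_op_comp.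
move=> u'; rewrite inE => /predU1P[->|Yu']; first by rewrite su !mul1r subrr.
by rewrite kill_r ?kill_s // mulr0 mul0r addr0.
Qed.

(** An operator agreeing with x * _ on ys is corrected at a further vector u by an
  operator which kills ys and is 1 at u; if there is none, [density] makes
  u a C(B)-combination of ys, and both maps, being C(B)-linear, agree at u
  already. The existence of the correcting operator is not decided, hence
  [classically]. *)
Lemma interpolation (ys : seq A) x : x \in 'C('C(B))%VS ->
  classically (exists2 t, mult_op t & {in ys, forall u, t u = x * u}).
Proof.
move=> /centvP CCx; have [K1 _ _] := fieldK; have B1 := subvP sKB 1 K1.
elim: ys => [|u ys].
  by move=> b; apply; exists (fun=> 0) => //; apply: mult_op0.
apply: classic_bind => -[t t_op Dt].
have [Cu | notCu] := boolP (u \in \sum_(u <- ys) 'C(B) * <[u]>)%VS.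
  move=> b; apply; exists t => // v.
  rewrite inE => /predU1P[->{v}|]; last exact: Dt.
  have [w Dw] := t_op.
  pose D := lker (linfun (two_sided (vbasis B) w) - amull x).
  have DE v : (v \in D) = (t v == x * v).
    by rewrite memv_ker add_lfunE opp_lfunE !lfunE /= subr_eq0 -Dw.
  apply/eqP; rewrite -DE; apply: subvP Cu; rewrite big_seq.
  apply: (big_ind (fun V => V <= D)%VS); first exact: sub0v.
    by move=> U V UD VD; rewrite subv_add UD.
  move=> v Yv; apply/prodvP=> c _ Cc /vlineP[k ->].
  by rewrite -scalerAr memvZ // DE (mult_op_cent _ t_op Cc) Dt // !mulrA CCx.
apply/classicP=> not_op; case/negP: notCu; apply: density => s s_op kill_s.
apply/eqP; apply/idPn => nz_su; case: not_op.
have [r [r_op ru kill_r]] := mult_op_to1 s_op nz_su.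
exists (fun y => t y + 1 * r y * (x * u - t u)).
  by apply: mult_opD; last apply: mult_op_comp.
move=> v; rewrite inE => /predU1P[->|Yv]; first by rewrite ru !mul1r subrKC.
by rewrite kill_r ?kill_s // mulr0 mul0r addr0 Dt.
Qed.

(** If x were not in B, then x (x) 1 = \sum_i b_i (x) w_i in A (x) A^op would be a
  relation between the free vectors x and b_i. *)
Lemma double_centraliser x : x \in 'C('C(B))%VS -> x \in B.
Proof.
move=> CCx; have/(_ (x \in B)) := @interpolation (vbasis {:A}) x CCx.
apply=> -[t [w Dw] Dt].
apply: contraT => notBx.
have /= : free (x :: vbasis B).
  by rewrite free_cons (basis_free (vbasisP B)) (span_basis (vbasisP B)) notBx.
pose w' i := if i is i'.+1 then w i' else -1.
move/(@two_sided_free _ _ csA _ w')/(_ _ 0%N isT) => /= w'0.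
suff /eqP: -1 = 0 :> A by rewrite oppr_eq0 oner_eq0.
apply: w'0 => y; rewrite /two_sided big_ord_recl /= -/(two_sided _ w y) mulrN1.
apply/eqP; rewrite addrC subr_eq0; apply/eqP.
rewrite (coord_vbasis (memvf y)) linear_sum mulr_sumr; apply: eq_bigr => i _.
by rewrite linearZ /= -Dw Dt ?scalerAr // mem_nth ?size_tuple.
Qed.

End Density.

(** * The stable value of the height filtration *)

Section Height.

Variables (F : fieldType) (A : falgType F) (K : {aspace A}) (K1 : 1 \in K).
Variables (a : A) (ua : a \is a GRing.unit).

Lemma Kam0 : Kam K a 0 = K.
Proof. by rewrite /Kam /= expr0 invr1 prodv1. Qed.

Lemma prodv_KaKX m : (K * KaKX K a m)%VS = KaKX K a m.
Proof. by case: m => [|m] /=; rewrite ?expvSl /KaK ?prodvA prodv_id. Qed.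

Lemma KaKX_S m : KaKX K a m.+1 = (K * <[a]> * KaKX K a m)%VS.
Proof.
rewrite -[in RHS]prodv_KaKX prodvA -/(KaK K a).
by case: m => [|m]; rewrite /= ?expv1 ?expvSl // /KaK -[RHS]prodvA prodv_id.
Qed.

Lemma Kam_S m : Kam K a m.+1 = (K * (<[a]> * Kam K a m * <[a^-1]>))%VS.
Proof.
rewrite /Kam KaKX_S exprS invrM ?unitrX // -prodv_line.
by rewrite -!prodvA.
Qed.

Lemma prodv_Kam m : (K * Kam K a m)%VS = Kam K a m.
Proof. by rewrite prodvA prodv_KaKX. Qed.

Lemma subfield_sub_Kam m : (K <= Kam K a m)%VS.
Proof.
by elim: m => [|m IH]; rewrite ?Kam0 // (subv_trans IH) // Kam_sub.
Qed.

Lemma Kam_stable m0 m : Kam K a m0 = Kam K a m0.+1 -> (m0 <= m)%N ->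
  Kam K a m = Kam K a m0.
Proof.
move=> stab; elim: m => [|m IH]; first by rewrite leqn0 => /eqP->.
by rewrite leq_eqVlt => /predU1P[<-//|le_m0_m]; rewrite stab Kam_S IH // -Kam_S.
Qed.

(** The sequence c_i stands for a^-i c_0 a^i; that c_i is in K says that c_0 commutes
  with a^i K a^-i, and these generate K(a, m). *)
Lemma cent_chain (c : nat -> A) m : {in K &, commutative *%R} ->
    (forall i, (i <= m)%N -> c i \in K) ->
    (forall i, (i < m)%N -> c i * a = a * c i.+1) ->
  c 0%N \in 'C(Kam K a m)%VS.
Proof.
move=> Kcomm; elim: m c => [|m IH] c Kc ca.
  by apply/centvP=> k; rewrite Kam0 => Kk; apply: Kcomm; rewrite ?Kc.
have /centvP c1C : c 1%N \in 'C(Kam K a m)%VS.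
  by apply: (IH (fun i => c i.+1)) => i le_i_m; [apply: Kc | apply: ca].
rewrite -subv_cent1 Kam_S; apply: prodv_sub.
  by apply/subvP=> k Kk; apply/cent1vP; apply: Kcomm; rewrite ?Kc.
rewrite -prodvA -limg_amulr.
apply/prodvP=> _ _ /vlineP[r ->] /memv_imgP[b Bb ->].
rewrite lfunE /= -scalerAl memvZ //; apply/cent1vP.
have -> : c 0%N = a * c 1%N * a^-1 by rewrite -ca // mulrK.
by rewrite !mulrA !divrK // -!(mulrA a) c1C.
Qed.

Section Stable.

Variables (m0 : nat) (stab : Kam K a m0 = Kam K a m0.+1).
Local Notation B := (Kam K a m0).

Let conj : 'End(A) := (amulr (a^-1)%R \o amull a)%VF.

Let conjE b : conj b = a * b * a^-1.
Proof. by rewrite comp_lfunE !lfunE. Qed.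

(** a B a^-1 is contained in K a B a^-1 = K(a, m0 + 1) = B and has the dimension
  of B. *)
Lemma conj_img : (conj @: B)%VS = B.
Proof.
have ker_conj : lker conj == 0%VS.
  apply/lker0P=> x y; rewrite !conjE => /(mulIr _)-/(_ _)/mulrI; apply=> //.
  by rewrite unitrV.
apply/eqP; rewrite eqEdim limg_dim_eq ?(eqP ker_conj) ?capv0 // leqnn andbT.
apply/subvP=> _ /memv_imgP[b Bb ->]; rewrite conjE stab Kam_S.
by rewrite -[_ * _]mul1r memv_mul // !memv_mul ?memv_line.
Qed.

Lemma conj_Kam b : b \in B -> a * b * a^-1 \in B.
Proof. by move=> Bb; rewrite -conjE -conj_img memv_img. Qed.

Lemma conjV_Kam b : b \in B -> a^-1 * b * a \in B.
Proof.
rewrite -{1}conj_img => /memv_imgP[b' Bb' ->].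
by rewrite conjE !mulrA mulVr // mul1r divrK.
Qed.

Lemma line_Kam : (<[a]> * B)%VS = (B * <[a]>)%VS.
Proof.
apply: subv_anti; apply/andP; split; apply/prodvP=> x y.
  move=> /vlineP[c ->] By; rewrite -scalerAl memvZ //.
  by rewrite -[a * y](divrK ua) memv_mul ?memv_line ?conj_Kam.
move=> Bx /vlineP[c ->]; rewrite -scalerAr memvZ //.
by rewrite -[x * a](mulVKr ua) memv_mul ?memv_line // mulrA conjV_Kam.
Qed.

Lemma lineX_Kam k : (<[a ^+ k]> * B)%VS = (B * <[a ^+ k]>)%VS.
Proof.
elim: k => [|k IH]; first by rewrite expr0 prodv1 prod1v.
by rewrite exprS -prodv_line -prodvA IH prodvA line_Kam -prodvA.
Qed.

Lemma lineV_Kam k : (<[a ^- k]> * B)%VS = (B * <[a ^- k]>)%VS.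
Proof.
have uk := unitrX k ua.
have VX : (<[a ^- k]> * <[a ^+ k]> = 1)%VS by rewrite prodv_line mulVr.
have XV : (<[a ^+ k]> * <[a ^- k]> = 1)%VS by rewrite prodv_line mulrV.
rewrite -[LHS]prodv1 -XV prodvA -[(_ * B * _)%VS]prodvA -lineX_Kam.
by rewrite !prodvA VX prod1v.
Qed.

Lemma prodv_KaKX_Kam m : (KaKX K a m * B)%VS = (B * <[a ^+ m]>)%VS.
Proof.
elim: m => [|m IH]; first by rewrite /= prodv_Kam expr0 prodv1.
rewrite KaKX_S -[LHS]prodvA IH [LHS]prodvA -(prodvA K) line_Kam prodvA prodv_Kam.
by rewrite -prodvA prodv_line -exprS.
Qed.

(** B B = (KaK)^m0 a^-m0 B = (KaK)^m0 B a^-m0 = B a^m0 a^-m0. *)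
Lemma prodv_Kam_id : (B * B)%VS = B.
Proof.
rewrite {1}/Kam -prodvA lineV_Kam prodvA prodv_KaKX_Kam -prodvA prodv_line.
by rewrite mulrV ?unitrX // prodv1.
Qed.

Lemma cent_conj c : c \in 'C(B)%VS -> a * c * a^-1 \in 'C(B)%VS.
Proof.
move=> /centvP cB; apply/centvP=> b Bb; have := cB _ (conjV_Kam Bb).
move/(congr1 (fun z => a * z * a^-1)).
by rewrite !mulrA mulrV // mul1r mulrK // -!mulrA mulVKr // !mulrA.
Qed.

Lemma cent_conjV c : c \in 'C(B)%VS -> a^-1 * c * a \in 'C(B)%VS.
Proof.
move=> /centvP cB; apply/centvP=> b Bb; have := cB _ (conj_Kam Bb).
move/(congr1 (fun z => a^-1 * z * a)).
by rewrite !mulrA mulVr // mul1r divrK // -!mulrA mulKr // !mulrA.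
Qed.

End Stable.

End Height.

(** * Reading commutation relations in the Galois closure *)

Section Correspondence.

Variables (F : fieldType) (A : falgType F) (K : {aspace A}).
Variables (K1 : 1 \in K) (Kcomm : {in K &, commutative *%R}).
Variables (L : splittingFieldType F) (j : 'AHom(subvs_of K, L)).
Variables (g : gal_of {:L}).

Local Notation T := (tensor (subvs_of K) (subvs_of K)).

Lemma vsval1 : vsval (1 : subvs_of K) = 1.
Proof. by apply/eqP; rewrite -[_ == _]/(algid K == 1) algid_eq1. Qed.

Lemma pi_tens x y : pi_ j g (tens x y) = j x * g (j y).
Proof.
rewrite lfunE /= tensor_liftE //; split=> [z c u v | z c u v] /=.
  by rewrite linearP mulrDl -scalerAl.
by rewrite !linearP mulrDr -scalerAr.
Qed.

Lemma pi_mul (s t : T) : pi_ j g (s * t) = pi_ j g s * pi_ j g t.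
Proof.
elim/tensor_ind: s => [c s s' IH IH' | x y].
  by rewrite mulrDl -scalerAl !linearP /= IH IH' mulrDl -scalerAl.
elim/tensor_ind: t => [c t t' IH IH' | x' y'].
  by rewrite mulrDr -scalerAr !linearP /= IH IH' mulrDr -scalerAr.
by rewrite tensM !pi_tens !rmorphM /= mulrACA.
Qed.

Lemma phi_tens v x y : phi_ K v (tens x y) = vsval x * v * vsval y.
Proof.
rewrite lfunE /= tensor_liftE //; split=> [z c u w | z c u w] /=.
  by rewrite !mulrDl -!scalerAl.
by rewrite mulrDr -scalerAr.
Qed.

Lemma phi_bimod v x y (t : T) :
  phi_ K v (tens x y * t) = vsval x * phi_ K v t * vsval y.
Proof.
elim/tensor_ind: t => [c t t' IH IH' | x' y'].
  rewrite mulrDr -scalerAr !linearP /= IH IH'.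
  by rewrite mulrDr -scalerAr mulrDl -scalerAl.
rewrite tensM !phi_tens /= (Kcomm (subvsP y) (subvsP y')).
by rewrite !mulrA.
Qed.

Lemma limg_phi v : KaK K v = {:A}%VS -> limg (phi_ K v) = {:A}%VS.
Proof.
move=> KvK; apply/eqP; rewrite eqEsubv subvf -KvK.
apply/prodvP=> x y Kvx Ky; pose P x := x * y \in limg (phi_ K v).
apply: (prodv_ind (P := P) _ _ _ Kvx); rewrite /P.
- by rewrite mul0r mem0v.
- by move=> c u w Iu Iw; rewrite mulrDl -scalerAl memvD ?memvZ.
move=> k _ Kk /vlineP[c ->].
rewrite -scalerAr -scalerAl memvZ //.
rewrite -[k]/(vsval (Subvs Kk)) -[y]/(vsval (Subvs Ky)) -phi_tens.
by rewrite memv_img ?memvf.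
Qed.

Lemma phi_inj v : KaK K v = {:A}%VS -> \dim {:A} = (\dim K ^ 2)%N ->
  lker (phi_ K v) == 0%VS.
Proof.
move=> KvK dimA; have := limg_ker_dim (phi_ K v) fullv.
have dimKv : dim (subvs_of K) = \dim K by [].
rewrite limg_phi // dimA capfv dimvf dim_matrix dimKv -mulnn => dimE.
by rewrite -dimv_eq0 -(eqn_add2r (\dim K * \dim K)) add0n; apply/eqP.
Qed.

(** Let t in K_[g] be the preimage of a under phi_v, and u = l (x) 1 - 1 (x) l'.
  Then l a - a l' = phi_v (u t), and phi_v is injective, so the left side says
  u t = 0. As K_[g] is minimal and not in the kernel of the ring morphism pi_g, it
  meets this kernel trivially; so u t = 0 is equivalent to
  pi_g(u) pi_g(t) = 0 with pi_g(t) <> 0, that is to l = g(l'). *)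
Lemma corresponds_comm a (l l' : subvs_of K) : \dim {:A} = (\dim K ^ 2)%N ->
    a != 0 -> corresponds j (KaK K a) g ->
  (vsval l * a = a * vsval l' <-> j l = g (j l')).
Proof.
move=> dimA nz_a [v [KvK [I [[[[idIl idIr] nzI minI] notkerI] DV]]]].
have kerphi := phi_inj KvK dimA.
have kerI : (I :&: lker (pi_ j g) = 0)%VS.
  have [] := minI (I :&: lker (pi_ j g))%VS => //; last 1 first.
  - by move=> IK; case/negP: notkerI; rewrite -{1}IK capvSr.
  - split; apply/prodvP=> s t.
      move=> _ /memv_capP[It]; rewrite memv_ker => /eqP kt.
      rewrite memv_cap memv_ker pi_mul kt mulr0 eqxx andbT.
      by rewrite (subvP idIl) ?memv_mul ?memvf.
    move=> /memv_capP[Is]; rewrite memv_ker => /eqP ks _.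
    rewrite memv_cap memv_ker pi_mul ks mul0r eqxx andbT.
    by rewrite (subvP idIr) ?memv_mul ?memvf.
  by rewrite capvSl.
have aV : a \in KaK K a.
  by rewrite -[X in X \in _]mulr1 -[X in X * 1]mul1r !memv_mul ?memv_line.
move: aV; rewrite DV => /memv_imgP[t It Da].
pose u : T := tens l 1 - tens 1 l'.
have phi_ut : phi_ K v (u * t) = vsval l * a - a * vsval l'.
  by rewrite mulrBl linearB /= !phi_bimod vsval1 !mulr1 !mul1r -Da.
have pi_u : pi_ j g u = j l - g (j l').
  by rewrite linearB /= !pi_tens !rmorph1 mulr1 mul1r.
have Iut : u * t \in I by rewrite (subvP idIl) ?memv_mul ?memvf.
have nz_pit : pi_ j g t != 0.
  apply: contraNneq nz_a => pit0; rewrite Da.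
  suff: t \in (I :&: lker (pi_ j g))%VS.
    by rewrite kerI memv0 => /eqP->; rewrite linear0.
  by rewrite memv_cap It memv_ker pit0 eqxx.
have phi0 : (u * t == 0) = (vsval l * a == a * vsval l').
  by rewrite -[RHS]subr_eq0 -phi_ut -memv_ker (eqP kerphi) memv0.
split=> [/eqP|/eqP].
  rewrite -phi0 => /eqP ut0; apply/eqP; rewrite -subr_eq0 -pi_u.
  have /eqP := pi_mul u t.
  by rewrite ut0 linear0 eq_sym mulf_eq0 (negPf nz_pit) orbF.
rewrite -subr_eq0 -pi_u => /eqP piu0; apply/eqP; rewrite -phi0 -memv0 -kerI.
by rewrite memv_cap Iut memv_ker pi_mul piu0 mul0r eqxx.
Qed.

End Correspondence.

(** * The field E as a centraliser *)

Section SubfieldImage.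

Variables (F : fieldType) (A : falgType F) (K : {aspace A}).
Variables (L : splittingFieldType F) (j : 'AHom(subvs_of K, L)).

Fact Kimg_is_aspace : is_aspace (Kimg j).
Proof.
rewrite /is_aspace has_algid1; last by rewrite -(rmorph1 j) memv_img ?memvf.
by rewrite -aimgM limgS ?subvf.
Qed.
Canonical Kimg_aspace := ASpace Kimg_is_aspace.

Lemma Kimg_inj : is_subfield K -> lker j == 0%VS.
Proof.
case=> K1 _ Kinv; rewrite -subv0; apply/subvP=> x; rewrite memv_ker memv0.
apply: contraTT => nz_x; have [ux _] := Kinv _ (subvsP x) nz_x.
apply/eqP=> jx0; have /eqP := rmorph1 j.
by rewrite -(mulrV (vsval_unitr ux)) rmorphM /= jx0 mul0r eq_sym oner_eq0.
Qed.

End SubfieldImage.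

Section FixedField.

Variables (F : fieldType) (A : falgType F) (csA : @central_simple F A).
Variables (K : {aspace A}) (fieldK : is_subfield K).
Hypothesis dimA : \dim {:A} = (\dim K ^ 2)%N.
Variables (L : splittingFieldType F) (j : 'AHom(subvs_of K, L)).
Variables (galL : galois 1 {:L}) (g : gal_of {:L}).
Variables (a : A) (ua : a \is a GRing.unit) (corr : corresponds j (KaK K a) g).
Variables (m0 : nat) (stab : Kam K a m0 = Kam K a m0.+1).

Local Notation B := (Kam K a m0).
Definition jK (c : A) : L := j (vsproj K c).

(** [corresponds_comm] with elements of A instead of the subtype. *)
Lemma twisted_comm c c' :
  c \in K -> c' \in K -> (c * a = a * c' <-> jK c = g (jK c')).
Proof.
have [K1 Kcomm _] := fieldK; move=> Kc Kc'; rewrite /jK.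
have nz_a : a != 0 by apply: contraTneq ua => ->; rewrite unitr0.
have := corresponds_comm K1 Kcomm (vsproj K c) (vsproj K c') dimA nz_a corr.
by rewrite !vsprojK.
Qed.

Lemma cent_sub_subfield c : c \in 'C(B)%VS -> c \in K.
Proof.
have [K1 _ _] := fieldK; move=> /centvP cB.
apply: (cent_subfield csA fieldK dimA); apply/centvP=> k Kk.
by apply: cB; apply: subvP (subfield_sub_Kam K1 ua m0) _ Kk.
Qed.

(** Conjugation by a acts on C(B) as g does on its image in L. *)
Lemma cent_conjX c i : c \in 'C(B)%VS ->
  a ^+ i * c * a ^- i \in 'C(B)%VS /\
  (g ^+ i)%g (jK c) = jK (a ^+ i * c * a ^- i).
Proof.
have [K1 _ _] := fieldK; move=> Cc.
elim: i => [|i [Cci IH]]; first by rewrite expr0 invr1 mul1r mulr1 expg0 gal_id.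
have -> : a ^+ i.+1 * c * a ^- i.+1 = a * (a ^+ i * c * a ^- i) * a^-1.
  by rewrite exprS invrM ?unitrX // !mulrA.
have Cci' := cent_conj K1 ua stab Cci; split=> //.
rewrite expgSr galM ?memvf // IH; apply/esym/twisted_comm.
- exact: cent_sub_subfield.
- exact: cent_sub_subfield.
by rewrite divrK.
Qed.

Lemma cent_conjXV c i : c \in 'C(B)%VS -> a ^- i * c * a ^+ i \in 'C(B)%VS.
Proof.
have [K1 _ _] := fieldK; move=> Cc.
elim: i => [|i IH]; first by rewrite expr0 invr1 mul1r mulr1.
have -> : a ^- i.+1 * c * a ^+ i.+1 = a^-1 * (a ^- i * c * a ^+ i) * a.
  by rewrite exprSr invrM ?unitrX // !mulrA.
exact: cent_conjV.
Qed.

Lemma Hgm_conj_sub i m : (i <= m)%N ->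
  ('Gal({:L} / Kimg j) :^ (g ^+ i) \subset Hgm j g m)%g.
Proof.
have one m' : (1 \in Hgm j g m')%g.
  elim: m' => [|m' IH] /=; first exact: group1.
  by rewrite -[1%g]mulg1 mem_mulg // group1.
elim: m => [|m IH]; first by rewrite leqn0 => /eqP->; rewrite conjsg1.
rewrite leq_eqVlt => /predU1P[-> | /IH sub_m] /=; first by rewrite mulg_subl.
by rewrite (subset_trans sub_m) // mulg_subr // group1.
Qed.

(** For every i, c = g^i(c') with c' = a^-i c a^i in K, so g^i H g^-i fixes c. *)
Lemma fixedField_cent c : c \in 'C(B)%VS -> jK c \in fixedField (Hgm j g m0).
Proof.
move=> Cc; apply/fixedFieldP; first exact: memvf.
elim: m0 => [|i IH] h /=.
  move=> Hh; apply: (fixed_gal (subvf (Kimg_aspace j)) Hh).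
  by rewrite memv_img ?memvf.
case/mulsgP=> h1 h2 /imsetP[h0 Hh0 ->] Hh2 ->.
rewrite galM ?memvf // -[RHS](IH _ Hh2); congr (h2 _).
have [_ gc] := cent_conjX i.+1 (cent_conjXV i.+1 Cc).
have Dc : a ^+ i.+1 * (a ^- i.+1 * c * a ^+ i.+1) * a ^- i.+1 = c.
  by rewrite !mulrA mulrV ?unitrX // mul1r mulrK ?unitrX.
rewrite Dc in gc; rewrite -gc conjgE !galM ?memvf //.
rewrite -[X in (g ^+ _)%g (h0 X)]galM ?memvf // mulgV gal_id.
congr (_ _); apply: (fixed_gal (subvf (Kimg_aspace j)) Hh0).
by rewrite memv_img ?memvf.
Qed.

(** Invariance under g^i H g^-i puts g^-i(l) in the fixed field of H, which is K as
  L / K is Galois. These elements of K form a sequence to which [cent_chain]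
  applies. *)
Lemma fixedField_centP l : l \in fixedField (Hgm j g m0) ->
  exists2 c, c \in 'C(B)%VS & l = jK c.
Proof.
have [K1 Kcomm _] := fieldK; move=> /mem_fixedFieldP[_ fix_l].
have fixK : fixedField ('Gal({:L} / Kimg j))%g = Kimg j.
  apply/(@galois_fixedField _ _ (Kimg_aspace j)).
  by apply: galoisS galL; rewrite sub1v subvf.
pose k i := (j^-1)%VF ((g ^- i)%g l).
have jk i : (i <= m0)%N -> j (k i) = (g ^- i)%g l.
  move=> le_i_m0; apply: limg_lfunVK; rewrite -/(Kimg j) -fixK.
  apply/fixedFieldP=> [|h Hh]; first exact: memvf.
  rewrite -galM ?memvf // -[(_ * h)%g]mulg1 -(mulgV (g ^+ i)%g).
  rewrite mulgA galM ?memvf //.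
  rewrite fix_l // (subsetP (Hgm_conj_sub le_i_m0)) //.
  by rewrite -mulgA -conjgE memJ_conjg.
exists (vsval (k 0%N)); last first.
  by rewrite /jK vsvalK jk // expg0 invg1 gal_id.
apply: (cent_chain (c := fun i => vsval (k i)) ua Kcomm) => [i _ | i lt_i_m0].
  exact: subvsP.
apply/twisted_comm; rewrite ?subvsP // /jK !vsvalK !jk ?(ltnW lt_i_m0) //.
by rewrite -galM ?memvf // expgS invMg mulgKV.
Qed.

End FixedField.

Theorem proposition31 (F : fieldType) (A : falgType F) (n : nat)
    (csA : central_simple A) (dimA : \dim {:A} = (n ^ 2)%N)
    (K : {aspace A}) (maxK : maximal_subfield K) (dimK : \dim K = n)
    (L : splittingFieldType F) (j : 'AHom(subvs_of K, L))
    (sepK : separable 1 (Kimg j)) (closL : galois_closure (Kimg j))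
    (g : gal_of {:L}) (a : A) (ua : a \is a GRing.unit)
    (simpleKaK : simple_sub_bimodule K (KaK K a))
    (corrKaK : corresponds j (KaK K a) g)
    (m0 : nat) (htm0 : is_height K a m0) (m : nat) (le_m0_m : (m0 <= m)%N)
    (x : A) :
  x \in KaKX K a m <->
  (forall l : L, l \in fixedField (Hgm j g m0) ->
     x * KtoA j l = KtoA j ((g ^+ m)%g l) * x).
Proof.
move: dimA; rewrite -dimK => {}dimA.
have [fieldK _] := maxK; have [K1 Kcomm _] := fieldK.
have [stab _] := htm0; have [galL _] := closL.
have uam : a ^+ m \is a GRing.unit by rewrite unitrX.
have KtoAK c : c \in K -> KtoA j (j (vsproj K c)) = c.
  by move=> Kc; rewrite /KtoA lker0_lfunK ?vsprojK // Kimg_inj.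
have CK c := cent_sub_subfield csA fieldK dimA ua (m0 := m0) (c := c).
have -> : (x \in KaKX K a m) = (x * a ^- m \in Kam K a m0).
  rewrite -(Kam_stable ua stab le_m0_m) /Kam -limg_amulr.
  apply/idP/memv_imgP=> [KXx | [y KXy]]; first by exists x; rewrite ?lfunE.
  by rewrite lfunE /= => /(mulIr _)->; rewrite ?unitrV.
have gX c := cent_conjX csA fieldK dimA ua corrKaK stab m (c := c).
split=> [Bxa l | comm_x].
  case/(fixedField_centP fieldK dimA galL ua corrKaK) => c Cc ->.
  have [Cc' ->] := gX c Cc; rewrite !KtoAK ?CK //.
  have /centvP/(_ _ Bxa) := Cc'; move/(congr1 (fun z => z * a ^+ m)).
  by rewrite !mulrA !divrK // mulrA => <-.
apply: (double_centraliser csA fieldK dimA).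
- exact: subfield_sub_Kam.
- by rewrite prodv_Kam_id.
apply/centvP=> c' Cc'.
have Cc := cent_conjXV fieldK ua stab m Cc'.
have := comm_x _ (fixedField_cent csA fieldK dimA ua corrKaK stab Cc).
have [_ ->] := gX _ Cc.
have -> : a ^+ m * (a ^- m * c' * a ^+ m) * a ^- m = c'.
  by rewrite !mulrA mulrV // mul1r mulrK.
rewrite !KtoAK ?CK // => /(congr1 (fun z => z * a ^- m)).
by rewrite !mulrA mulrK.
Qed.
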